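(* Let $\tau>0$ and let $\gamma:I\to \mathrm{SL}(2,\mathbb{R})_\tau\subset\mathbb{R}^4_2$ be a proper biharmonic curve parametrized by arc length, with $\gamma'(s)=\cos\vartheta\,E_1+\sin\vartheta\sin\beta(s)\,E_2+\sin\vartheta\cos\beta(s)\,E_3$, where $\vartheta\in(0,\pi/2]$ is constant and $\beta:I\to\mathbb{R}$ is smooth. Let $b=\beta'$ and $a=\frac12\big(-\tau^{-2}+1-(1+\tau^{-2})\cos2\vartheta\big)-\tau^{-1}\cos\vartheta\,\beta'$ (these are constant along $\gamma$), and suppose that $b^2>4a$. Then there are two possibilities: (i) $b=-\tau^{-1}(2+\tau^2)\cos\vartheta+\sqrt{(4+5\tau^2)\cos^2\vartheta-4(1+\tau^2)}$ and $$\frac{4(1+\tau^2)}{4+5\tau^2}\le\cos^2\vartheta<\frac{(2+\tau^2)^2}{4+5\tau^2+\tau^4};$$ (ii) $b=-\tau^{-1}(2+\tau^2)\cos\vartheta-\sqrt{(4+5\tau^2)\cos^2\vartheta-4(1+\tau^2)}$ and $$\frac{4(1+\tau^2)}{4+5\tau^2}\le\cos^2\vartheta.$$ In both cases, the expression of $\gamma$ as a curve in $\mathbb{R}^4_2$ is $$\gamma(s)=A\big(\sqrt{C_{33}}\cos(\alpha_2 s),\ \sqrt{C_{33}}\sin(\alpha_2 s),\ \sqrt{-C_{11}}\cos(\alpha_1 s),\ \sqrt{-C_{11}}\sin(\alpha_1 s)\big),$$ where $$\alpha_{1,2}=\sqrt{\frac{(b^2-2a)\pm\sqrt{b^2(b^2-4a)}}{2}}$$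 (with the sign $+$ for $\alpha_1$ and $-$ for $\alpha_2$) and $$C_{11}=\frac{\tilde B-\alpha_2^2}{\alpha_1^2-\alpha_2^2},\qquad C_{33}=\frac{-\tilde B+\alpha_1^2}{\alpha_1^2-\alpha_2^2},\qquad \tilde B=(1+\tau^{-2})\cos^2\vartheta-1,$$ are real constants, and $A\in\mathrm{O}_2(4)$ is some $4\times4$ indefinite orthogonal (constant) matrix anticommuting with $J_1$.
   Context: Let $\mathbb{R}^4_2$ be $\mathbb{R}^4$ with the inner product $\langle v,w\rangle=v_1w_1+v_2w_2-v_3w_3-v_4w_4$; identify $\mathbb{R}^4$ with $\mathbb{C}^2$ via $(z,w)=(x_1+ix_2,x_3+ix_4)$, and identify $\mathrm{SL}(2,\mathbb{R})$ with $\{(z,w)\in\mathbb{C}^2: |z|^2-|w|^2=1\}=\{v\in\mathbb{R}^4_2:\langle v,v\rangle=1\}$. On it consider the tangent vector fields $$X_1(z,w)=(iz,iw),\quad X_2(z,w)=(i\bar w,i\bar z),\quad X_3(z,w)=(\bar w,\bar z).$$ For $\tau>0$, $\mathrm{SL}(2,\mathbb{R})_\tau$ denotes $\mathrm{SL}(2,\mathbb{R})$ with the Riemannian metric $g_\tau(X,Y)=-\langle X,Y\rangle+(1+\tau^2)\langle X,X_1\rangle\langle Y,X_1\rangle$. Then $E_1=-\tau^{-1}X_1$, $E_2=X_2$, $E_3=X_3$ is a global orthonormal frame (evaluated at $\gamma(s)$ in formulas for $\gamma'(s)$). Let $\nabla^\tau$ be the Levi-Civita connection of $g_\tau$ and $R(X,Y)Z=\nabla^\tau_X\nabla^\tau_YZ-\nabla^\tau_Y\nabla^\tau_XZ-\nabla^\tau_{[X,Y]}Z$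 its curvature. Curves are smooth and defined on an open interval $I$. A curve $\gamma$ parametrized by arc length, with $T=\gamma'$, is biharmonic if its bitension field vanishes, i.e. $(\nabla^\tau_T)^3T-R(T,\nabla^\tau_TT)T=0$; it is proper biharmonic if it is biharmonic and not a geodesic. $J_1=\begin{pmatrix}J&0\\0&J\end{pmatrix}$ with $J=\begin{pmatrix}0&-1\\1&0\end{pmatrix}$, and $\mathrm{O}_2(4)=\{A\in\mathrm{GL}(4,\mathbb{R}):A^t=\epsilon A^{-1}\epsilon\}$ with $\epsilon=\mathrm{diag}(1,1,-1,-1)$. Anticommuting means $J_1A=-AJ_1$. $A$ acts on the coordinate vector as a column vector. *)

(* Defs.v *)
From HB Require Import structures.
From mathcomp Require Import all_boot all_order all_algebra.
From mathcomp Require Import all_classical all_reals all_analysis.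
From mathcomp Require Import complex.

Set Implicit Arguments.
Unset Strict Implicit.
Unset Printing Implicit Defensive.

Import Order.TTheory GRing.Theory Num.Theory.
Import numFieldNormedType.Exports.

Local Open Scope ring_scope.
Local Open Scope classical_set_scope.

Definition vec4 {R : realType} (a b c d : R) : 'cV[R]_4 :=
  \col_i [:: a; b; c; d]`_i.

Definition lor {R : realType} (v w : 'cV[R]_4) : R :=
  v 0 0 * w 0 0 + v 1 0 * w 1 0 - v 2 0 * w 2 0 - v 3 0 * w 3 0.

Definition zcoord {R : realType} (v : 'cV[R]_4) : R[i] :=
  Complex (v 0 0) (v 1 0).
Definition wcoord {R : realType} (v : 'cV[R]_4) : R[i] :=
  Complex (v 2 0) (v 3 0).
Definition of_C2 {R : realType} (z w : R[i]) : 'cV[R]_4 :=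
  vec4 (complex.Re z) (complex.Im z) (complex.Re w) (complex.Im w).

Definition SL2 {R : realType} : set 'cV[R]_4 := [set v | lor v v = 1].

(* An open neighbourhood of [SL2] in the ambient space.  It retracts smoothly
   onto [SL2] by [v |-> v / sqrt <v,v>], so the smooth maps on the hypersurface
   are exactly the restrictions of the maps smooth on this cone.  A function or
   vector field on [SL2] is represented below by such an extension, and all
   identities between them are only required at the points of [SL2]. *)
Definition SL2_nbhd {R : realType} : set 'cV[R]_4 := [set v | 0 < lor v v].

Definition X1 {R : realType} (p : 'cV[R]_4) : 'cV[R]_4 :=
  of_C2 ('i%C * zcoord p) ('i%C * wcoord p).
Definition X2 {R : realType} (p : 'cV[R]_4) : 'cV[R]_4 :=
  of_C2 ('i%C * conjc (wcoord p)) ('i%C * conjc (zcoord p)).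
Definition X3 {R : realType} (p : 'cV[R]_4) : 'cV[R]_4 :=
  of_C2 (conjc (wcoord p)) (conjc (zcoord p)).

Definition g {R : realType} (tau : R) (p u v : 'cV[R]_4) : R :=
  - lor u v + (1 + tau ^+ 2) * lor u (X1 p) * lor v (X1 p).

Definition E1 {R : realType} (tau : R) (p : 'cV[R]_4) : 'cV[R]_4 :=
  - tau^-1 *: X1 p.
Definition E2 {R : realType} (p : 'cV[R]_4) : 'cV[R]_4 := X2 p.
Definition E3 {R : realType} (p : 'cV[R]_4) : 'cV[R]_4 := X3 p.
Definition frame {R : realType} (tau : R) (i : 'I_3) : 'cV[R]_4 -> 'cV[R]_4 :=
  nth (fun=> 0) [:: E1 tau; E2; E3] i.

Fixpoint Cn {R : realType} {V W : normedModType R} (n : nat) (U : set V)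
    (F : V -> W) : Prop :=
  match n with
  | 0 => forall p, U p -> {for p, continuous F}
  | m.+1 => forall v : V,
      (forall p, U p -> derivable F p v) /\ Cn m U (fun p => 'D_v F p)
  end.

Definition smooth_fun {R : realType} (f : 'cV[R]_4 -> R) : Prop :=
  forall n, Cn n SL2_nbhd (f : 'cV[R]_4 -> R^o).

Definition vector_field {R : realType} (X : 'cV[R]_4 -> 'cV[R]_4) : Prop :=
  (forall n, Cn n SL2_nbhd X) /\ (forall p, SL2 p -> lor p (X p) = 0).

(* At a point of [SL2], for tangent fields, this is the Lie bracket on the
   hypersurface and does not depend on the extensions. *)
Definition bracket {R : realType} (X Y : 'cV[R]_4 -> 'cV[R]_4)
    (p : 'cV[R]_4) : 'cV[R]_4 :=
  'D_(X p) Y p - 'D_(Y p) X p.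

Definition connection_type (R : realType) : Type :=
  ('cV[R]_4 -> 'cV[R]_4) -> ('cV[R]_4 -> 'cV[R]_4) -> 'cV[R]_4 -> 'cV[R]_4.

Record affine_connection {R : realType} (nabla : connection_type R) : Prop := {
  conn_field : forall X Y, vector_field X -> vector_field Y ->
    vector_field (nabla X Y);
  (* [nabla] depends only on the fields along [SL2], not on the extensions *)
  conn_restr : forall X X' Y Y', vector_field X -> vector_field X' ->
    vector_field Y -> vector_field Y' ->
    (forall p, SL2 p -> X p = X' p) -> (forall p, SL2 p -> Y p = Y' p) ->
    forall p, SL2 p -> nabla X Y p = nabla X' Y' p;
  conn_addl : forall X X' Y, vector_field X -> vector_field X' ->
    vector_field Y -> forall p, SL2 p ->
    nabla (fun q => X q + X' q) Y p = nabla X Y p + nabla X' Y p;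
  conn_scalel : forall f X Y, smooth_fun f -> vector_field X ->
    vector_field Y -> forall p, SL2 p ->
    nabla (fun q => f q *: X q) Y p = f p *: nabla X Y p;
  conn_addr : forall X Y Y', vector_field X -> vector_field Y ->
    vector_field Y' -> forall p, SL2 p ->
    nabla X (fun q => Y q + Y' q) p = nabla X Y p + nabla X Y' p;
  conn_leibniz : forall f X Y, smooth_fun f -> vector_field X ->
    vector_field Y -> forall p, SL2 p ->
    nabla X (fun q => f q *: Y q) p =
      'D_(X p) (f : 'cV[R]_4 -> R^o) p *: Y p + f p *: nabla X Y p
}.

Record levi_civita {R : realType} (tau : R) (nabla : connection_type R)
    : Prop := {
  lc_conn : affine_connection nabla;
  lc_torsion : forall X Y, vector_field X -> vector_field Y ->
    forall p, SL2 p -> nabla X Y p - nabla Y X p = bracket X Y p;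
  lc_metric : forall X Y Z, vector_field X -> vector_field Y ->
    vector_field Z -> forall p, SL2 p ->
    'D_(X p) (fun q => g tau q (Y q) (Z q) : R^o) p =
      g tau p (nabla X Y p) (Z p) + g tau p (Y p) (nabla X Z p)
}.

Definition curvature {R : realType} (nabla : connection_type R)
    (X Y Z : 'cV[R]_4 -> 'cV[R]_4) (p : 'cV[R]_4) : 'cV[R]_4 :=
  nabla X (nabla Y Z) p - nabla Y (nabla X Z) p - nabla (bracket X Y) Z p.

(* The field with constant coefficients in the orthonormal frame that takes
   the value [u] at [p], for [u] tangent at [p]. *)
Definition frame_ext {R : realType} (tau : R) (p u q : 'cV[R]_4) : 'cV[R]_4 :=
  \sum_(i < 3) g tau p u (frame tau i p) *: frame tau i q.

(* The curvature is a tensor, so any extension of the vectors will do. *)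
Definition curvature_at {R : realType} (tau : R) (nabla : connection_type R)
    (p u v w : 'cV[R]_4) : 'cV[R]_4 :=
  curvature nabla (frame_ext tau p u) (frame_ext tau p v) (frame_ext tau p w) p.

Definition rderiv {R : realType} (f : R -> R) (s : R) : R :=
  derive1 (f : R -> R^o) s.

(* The covariant derivative along [gam] of a field [V] along [gam]: with
   V = sum_i V_i E_i, it is sum_i (V_i' E_i + V_i nabla_{gam'} E_i). *)
Definition cov_deriv {R : realType} (tau : R) (nabla : connection_type R)
    (gam V : R -> 'cV[R]_4) (s : R) : 'cV[R]_4 :=
  \sum_(i < 3)
    (rderiv (fun t => g tau (gam t) (V t) (frame tau i (gam t))) s
       *: frame tau i (gam s)
     + g tau (gam s) (V s) (frame tau i (gam s))
       *: nabla (frame_ext tau (gam s) (derive1 gam s)) (frame tau i) (gam s)).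

Definition smooth_on {R : realType} {V : normedModType R} (I : set R)
    (f : R -> V) : Prop :=
  forall n s, I s -> derivable (derive1n n f) s 1.

Definition curve {R : realType} (I : set R) (gam : R -> 'cV[R]_4) : Prop :=
  [/\ open I, is_interval I, smooth_on I gam & forall s, I s -> SL2 (gam s)].

Definition arc_length {R : realType} (tau : R) (I : set R)
    (gam : R -> 'cV[R]_4) : Prop :=
  forall s, I s -> g tau (gam s) (derive1 gam s) (derive1 gam s) = 1.

Definition geodesic {R : realType} (tau : R) (nabla : connection_type R)
    (I : set R) (gam : R -> 'cV[R]_4) : Prop :=
  forall s, I s -> cov_deriv tau nabla gam (derive1 gam) s = 0.

Definition bitension {R : realType} (tau : R) (nabla : connection_type R)
    (gam : R -> 'cV[R]_4) (s : R) : 'cV[R]_4 :=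
  let T := derive1 gam in
  let D := cov_deriv tau nabla gam in
  D (D (D T)) s - curvature_at tau nabla (gam s) (T s) (D T s) (T s).

Definition biharmonic {R : realType} (tau : R) (nabla : connection_type R)
    (I : set R) (gam : R -> 'cV[R]_4) : Prop :=
  forall s, I s -> bitension tau nabla gam s = 0.

Definition proper_biharmonic {R : realType} (tau : R)
    (nabla : connection_type R) (I : set R) (gam : R -> 'cV[R]_4) : Prop :=
  biharmonic tau nabla I gam /\ ~ geodesic tau nabla I gam.

Definition J {R : realType} : 'M[R]_2 :=
  \matrix_(i, j) nth 0 (nth [::] [:: [:: 0; -1]; [:: 1; 0]] i) j.
Definition J1 {R : realType} : 'M[R]_4 := block_mx J 0 0 J : 'M[R]_(2 + 2).

Definition eps {R : realType} : 'M[R]_4 :=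
  diag_mx (\row_j [:: 1; 1; -1; -1]`_j).

Definition O2_4 {R : realType} (A : 'M[R]_4) : Prop :=
  A \in unitmx /\ A^T = eps *m invmx A *m eps.

Definition acoef {R : realType} (tau theta b : R) : R :=
  2^-1 * (- tau ^- 2 + 1 - (1 + tau ^- 2) * cos (2 * theta))
  - tau^-1 * cos theta * b.
Definition alpha1 {R : realType} (a b : R) : R :=
  Num.sqrt ((b ^+ 2 - 2 * a + Num.sqrt (b ^+ 2 * (b ^+ 2 - 4 * a))) / 2).
Definition alpha2 {R : realType} (a b : R) : R :=
  Num.sqrt ((b ^+ 2 - 2 * a - Num.sqrt (b ^+ 2 * (b ^+ 2 - 4 * a))) / 2).
Definition Btilde {R : realType} (tau theta : R) : R :=
  (1 + tau ^- 2) * cos theta ^+ 2 - 1.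
Definition C11 {R : realType} (tau theta a b : R) : R :=
  (Btilde tau theta - alpha2 a b ^+ 2) / (alpha1 a b ^+ 2 - alpha2 a b ^+ 2).
Definition C33 {R : realType} (tau theta a b : R) : R :=
  (- Btilde tau theta + alpha1 a b ^+ 2) / (alpha1 a b ^+ 2 - alpha2 a b ^+ 2).

(* Since [Num.sqrt] is 0 on negative numbers and division by 0 is total, these
   inequalities say that the expressions above, and the square roots of
   C33 and - C11, are genuine real numbers. *)
Definition real_constants {R : realType} (tau theta a b : R) : Prop :=
  [/\ 0 <= b ^+ 2 * (b ^+ 2 - 4 * a),
      0 <= b ^+ 2 - 2 * a - Num.sqrt (b ^+ 2 * (b ^+ 2 - 4 * a)),
      alpha1 a b ^+ 2 != alpha2 a b ^+ 2,
      0 <= C33 tau theta a b & 0 <= - C11 tau theta a b].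

(* Main.v *)
Require Import Defs.
From mathcomp Require Import all_boot all_order all_algebra.
From mathcomp Require Import all_classical all_reals all_analysis.
From mathcomp Require Import ring lra.
Import Order.TTheory GRing.Theory Num.Theory.
Import numFieldNormedType.Exports.
Local Open Scope ring_scope.
Local Open Scope classical_set_scope.

(** The fields [E1], [E2], [E3] are left-invariant and linear in the ambient
    coordinates, so the whole geometry reduces to algebra on the coefficients
    of fields that are constant in this frame: Koszul's formula
    ([koszul_frame]) determines the connection and the curvature
    ([nabla_frame], [curvature_atE]).

    Write kappa for the geodesic curvature, here
    sin theta * (beta' + 2 (1 + tau^2) cos theta / tau), up to sign.  The
    tangential part of the bitension field is - 3 kappa kappa', so kappa^2 is
    constant; as the curve is not a geodesic, kappa is a nonzero constant,
    hence so is b = beta' ([proper_biharmonic_angle]).  The part of the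
    bitension field along the principal normal then says that
    q = b + (2 + tau^2) cos theta / tau satisfies
    q^2 = (4 + 5 tau^2) cos^2 theta - 4 (1 + tau^2); the sign of q separates
    the two cases, and for q >= 0 the hypothesis b^2 > 4 a becomes the extra
    upper bound on cos^2 theta ([cos2_lt]).

    The curve solves gam'' = b i gam' + a gam, where i is the complex structure
    [X1] of C^2.  Its characteristic frequencies satisfy
    alpha1 + alpha2 = - b and alpha1 alpha2 = a, and the two numbers are exactly
    those of the theorem because b < 0 and a > 0 ([alpha_roots]).  Hence gam is
    the sum of two vectors of C^2 that rotate uniformly with speeds - alpha1 and
    - alpha2 ([component_derive], [component_sum]).  They are orthogonal for the
    Hermitian form of signature (1, 1) and have squared lengths C11 < 0 and
    C33 > 0 ([lor_component]).  Normalized, they are the third and first columns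
    of A; anticommutation with [J1] dictates the other two
    ([O2_4_anticommuting]).  The rotations run backwards, which is why A is
    antilinear rather than linear. *)

(** * Coordinates and the global frame *)
Lemma vec4_ext {R : realType} (u v : 'cV[R]_4) :
  u 0 0 = v 0 0 -> u 1 0 = v 1 0 -> u 2 0 = v 2 0 -> u 3 0 = v 3 0 -> u = v.
Proof.
move=> h0 h1 h2 h3; apply/matrixP => i j; rewrite (ord1 j) {j}.
case: i => [[|[|[|[|i]]]] Hi] //.
- by have -> : Ordinal Hi = 0 by apply: val_inj.
- by have -> : Ordinal Hi = 1 by apply: val_inj.
- by have -> : Ordinal Hi = 2 by apply: val_inj.
- by have -> : Ordinal Hi = 3 by apply: val_inj.
Qed.

Lemma vec4E {R : realType} (a b c d : R) :
  (vec4 a b c d 0 0 = a) * (vec4 a b c d 1 0 = b) *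
  (vec4 a b c d 2 0 = c) * (vec4 a b c d 3 0 = d).
Proof. by rewrite /vec4 !mxE. Qed.

Lemma X1E {R : realType} (p : 'cV[R]_4) :
  X1 p = vec4 (- p 1 0) (p 0 0) (- p 3 0) (p 2 0).
Proof. rewrite /X1 /of_C2 /=; congr vec4; ring. Qed.

Lemma X2E {R : realType} (p : 'cV[R]_4) :
  X2 p = vec4 (p 3 0) (p 2 0) (p 1 0) (p 0 0).
Proof. rewrite /X2 /of_C2 /=; congr vec4; ring. Qed.

Lemma X3E {R : realType} (p : 'cV[R]_4) :
  X3 p = vec4 (p 2 0) (- p 3 0) (p 0 0) (- p 1 0).
Proof. by []. Qed.

(** Fields with constant coefficients in the frame: each is the restriction of
    a linear map of the ambient space, and every computation below takes place
    among them. *)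
Definition frame_comb {R : realType} (tau : R) (u : R * R * R)
    (q : 'cV[R]_4) : 'cV[R]_4 :=
  u.1.1 *: E1 tau q + u.1.2 *: E2 q + u.2 *: E3 q.

Lemma frame_combE {R : realType} (tau : R) u q :
  frame_comb tau u q = vec4
    (u.1.1 * tau^-1 * q 1 0 + u.1.2 * q 3 0 + u.2 * q 2 0)
    (- u.1.1 * tau^-1 * q 0 0 + u.1.2 * q 2 0 - u.2 * q 3 0)
    (u.1.1 * tau^-1 * q 3 0 + u.1.2 * q 1 0 + u.2 * q 0 0)
    (- u.1.1 * tau^-1 * q 2 0 + u.1.2 * q 0 0 - u.2 * q 1 0).
Proof.
rewrite /frame_comb /E1 /E2 /E3 X1E X2E X3E.
apply: vec4_ext; rewrite vec4E !mxE /=; ring.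
Qed.

Lemma E1_frame {R : realType} (tau : R) : E1 tau = frame_comb tau (1, 0, 0).
Proof.
by apply/funext => p; rewrite /frame_comb scale1r !scale0r !addr0.
Qed.

Lemma E2_frame {R : realType} (tau : R) : E2 = frame_comb tau (0, 1, 0).
Proof.
by apply/funext => p; rewrite /frame_comb scale1r !scale0r addr0 add0r.
Qed.

Lemma E3_frame {R : realType} (tau : R) : E3 = frame_comb tau (0, 0, 1).
Proof.
by apply/funext => p; rewrite /frame_comb scale1r !scale0r !add0r.
Qed.

Lemma frame_comb_linear {R : realType} (tau : R) u k p q :
  frame_comb tau u (k *: p + q)
  = k *: frame_comb tau u p + frame_comb tau u q.
Proof.
rewrite !frame_combE; apply: vec4_ext; rewrite !(vec4E, mxE) /=; ring.
Qed.

(** * Linear fields are admissible vector fields *)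
Lemma is_derive_linear {R : realType} (V W : normedModType R) (f : V -> W)
    (p v : V) :
  (forall k x y, f (k *: x + y) = k *: f x + f y) -> is_derive p v f (f v).
Proof.
move=> fL.
have fC : (fun h : R => h^-1 *: ((f \o shift p) (h *: v) - f p)) @ 0^' --> f v.
  apply: cvg_trans (cvg_cst (f v)).
  apply: near_eq_cvg; near=> h => /=.
  rewrite fL addrK scalerA mulVf ?scale1r //.
  near: h; exact: nbhs_dnbhs_neq.
exact: dnbhs_filter.
by apply: DeriveDef; [apply/cvg_ex; exists (f v) | apply: cvg_lim].
Unshelve. all: by end_near. Qed.

(** Finite dimension gives continuity: a linear map on columns is a finite
    combination of the coordinates. *)
Lemma linear_continuous_col {R : realType} n (W : normedModType R)
    (f : 'cV[R]_n -> W) :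
  (forall k x y, f (k *: x + y) = k *: f x + f y) -> continuous f.
Proof.
move=> fL p.
have f0 : f 0 = 0.
  by have := fL (-1) 0 0; rewrite scaler0 addr0 scaleN1r addNr.
have fE q : f q = \sum_(i < n) q i 0 *: f (delta_mx i 0).
  rewrite {1}[q]matrix_sum_delta; under eq_bigr do rewrite big_ord1.
  elim/big_rec2: _ => [//|i y1 y2 _ <-]; exact: fL.
have -> : f = fun q => \sum_(i < n) q i 0 *: f (delta_mx i 0) by apply/funext.
apply: (@cvg_big _ _ _ _ _ _ _ (nbhs p) _ _ _ (nbhs_filter p)) => [|i _].
  exact: add_continuous.
pose x (q : 'cV[R]_n) := q i 0.
have xC : x @ p --> p i 0 by exact: coord_continuous.
exact: (@cvgZr_tmp R W _ (nbhs p) (nbhs_filter p) x _ (f (delta_mx i 0)) xC).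
Qed.

Lemma Cn_cst {R : realType} (V W : normedModType R) n (U : set V) (w : W) :
  Cn n U (fun=> w).
Proof.
elim: n w => [|n IH] w /=; first by move=> p _; exact: cvg_cst.
move=> v; split; first by move=> p _; exact: derivable_cst.
have -> : (fun p => 'D_v (fun=> w) p) = fun=> 0 :> W; last exact: IH.
by apply/funext => p; exact: derive_cst.
Qed.

Lemma Cn_linear {R : realType} k (W : normedModType R) n (U : set 'cV[R]_k)
    (f : 'cV[R]_k -> W) :
  (forall k x y, f (k *: x + y) = k *: f x + f y) -> Cn n U f.
Proof.
move=> fL; case: n => [|n] /=.
  by move=> p _; exact: linear_continuous_col.
have fd p v := is_derive_linear _ _ f p v fL.
move=> v; split; first by move=> p _; have [] := fd p v.
have -> : (fun p => 'D_v f p) = fun=> f v; last exact: Cn_cst.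
by apply/funext => p; have [] := fd p v.
Qed.

Lemma lor_frame_comb {R : realType} (tau : R) u q :
  lor q (frame_comb tau u q) = 0.
Proof. rewrite frame_combE /lor !vec4E; ring. Qed.

Lemma frame_comb_field {R : realType} (tau : R) u :
  vector_field (frame_comb tau u).
Proof.
split=> [n|p _]; last exact: lor_frame_comb.
by apply: Cn_linear => k x y; exact: frame_comb_linear.
Qed.

(** * The Levi-Civita connection in the frame *)

(** At every point of the ambient space the product of two frame fields is a
    function of <q, q> alone; hence its derivative vanishes in the directions
    tangent to the hypersurface, although it is not constant off it. *)
Lemma g_frame {R : realType} (tau : R) u v q :
  g tau q (frame_comb tau u q) (frame_comb tau v q) =
  u.1.1 * v.1.1 * tau^-1 ^+ 2 * (- lor q q + (1 + tau ^+ 2) * lor q q ^+ 2)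
  + (u.1.2 * v.1.2 + u.2 * v.2) * lor q q.
Proof. rewrite !frame_combE /g X1E /lor !vec4E; ring. Qed.

Definition dot3 {R : realType} (u v : R * R * R) : R :=
  u.1.1 * v.1.1 + u.1.2 * v.1.2 + u.2 * v.2.

Lemma g_frame_SL2 {R : realType} (tau : R) u v q : tau != 0 -> SL2 q ->
  g tau q (frame_comb tau u q) (frame_comb tau v q) = dot3 u v.
Proof.
move=> t0; rewrite g_frame /SL2 /= => ->; rewrite /dot3; field; exact: t0.
Qed.

(** The vectors p, X1 p, X2 p, X3 p are orthogonal of squared lengths
    1, 1, -1, -1 when <p, p> = 1, so they expand any vector; tangency kills the
    component along p. *)
Lemma frame_decomp {R : realType} (tau : R) (p w : 'cV[R]_4) :
  tau != 0 -> SL2 p -> lor p w = 0 ->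
  w = frame_comb tau
    (g tau p w (E1 tau p), g tau p w (E2 p), g tau p w (E3 p)) p.
Proof.
move=> t0 p1 pw.
(* Each coordinate identity holds modulo the two relations <p, p> = 1 and
   <p, w> = 0, with these multipliers. *)
have lincomb x i : - x + w i 0 = (1 - lor p p) * w i 0 + lor p w * p i 0 ->
    w i 0 = x.
  rewrite p1 pw subrr !mul0r addr0 => /eqP.
  by rewrite addrC subr_eq0 => /eqP.
have g1 : g tau p w (E1 tau p) = - tau * lor w (X1 p).
  have -> : g tau p w (E1 tau p)
    = (tau^-1 - (1 + tau ^+ 2) * tau^-1 * lor p p) * lor w (X1 p).
    by rewrite /g /E1 X1E /lor !(vec4E, mxE); ring.
  by rewrite p1; field.
have g2 : g tau p w (E2 p) = - lor w (X2 p).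
  by rewrite /g /E2 X1E X2E /lor !vec4E; ring.
have g3 : g tau p w (E3 p) = - lor w (X3 p).
  by rewrite /g /E3 X1E X3E /lor !vec4E; ring.
rewrite frame_combE /= g1 g2 g3 X1E X2E X3E.
by apply: vec4_ext; rewrite !vec4E; apply: lincomb; rewrite /lor !vec4E; field.
Qed.

Lemma is_derive_lor {R : realType} (p v : 'cV[R]_4) :
  is_derive p v (fun q => lor q q : R^o) (2 * lor p v).
Proof.
have C (i : 'I_4) : is_derive p v (fun q : 'cV[R]_4 => q i 0 : R^o) (v i 0).
  apply: (is_derive_linear _ _ (fun q : 'cV[R]_4 => q i 0 : R^o)) => k x y.
  by rewrite !mxE.
have sq i := is_deriveM (C i) (C i).
apply: is_derive_eq (is_deriveB (is_deriveB (is_deriveD (sq 0) (sq 1)) (sq 2))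
  (sq 3)) _.
rewrite /lor /GRing.scale /=; ring.
Qed.

Lemma derive_g_frame {R : realType} (tau : R) u v (p w : 'cV[R]_4) :
  lor p w = 0 ->
  'D_w (fun q => g tau q (frame_comb tau u q) (frame_comb tau v q) : R^o) p
  = 0.
Proof.
move=> pw.
set N := fun q : 'cV[R]_4 => lor q q : R^o.
have dN : is_derive p w N 0.
  by apply: is_derive_eq; [exact: is_derive_lor | rewrite pw mulr0].
have -> : (fun q => g tau q (frame_comb tau u q) (frame_comb tau v q) : R^o)
  = (u.1.1 * v.1.1 * tau^-1 ^+ 2) *: (- N + (1 + tau ^+ 2) *: (N * N))
    + (u.1.2 * v.1.2 + u.2 * v.2) *: N.
  by apply/funext => q; rewrite g_frame !fctE expr2.
rewrite (derive_val (is_derive := is_deriveD (is_deriveZ _ (is_deriveD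
  (is_deriveN dN) (is_deriveZ _ (is_deriveM dN dN)))) (is_deriveZ _ dN))).
by rewrite !(scaler0, oppr0, addr0).
Qed.

(** Structure constants: [E1, E2] = - 2/tau E3, [E2, E3] = 2 tau E1 and
    [E3, E1] = - 2/tau E2. *)
Definition bracket_coef {R : realType} (tau : R) (u v : R * R * R) :
    R * R * R :=
  (2 * tau * (u.1.2 * v.2 - u.2 * v.1.2),
   - 2 * tau^-1 * (u.2 * v.1.1 - u.1.1 * v.2),
   - 2 * tau^-1 * (u.1.1 * v.1.2 - u.1.2 * v.1.1)).

Lemma bracket_frame {R : realType} (tau : R) u v : tau != 0 ->
  bracket (frame_comb tau u) (frame_comb tau v)
  = frame_comb tau (bracket_coef tau u v).
Proof.
move=> t0; apply/funext => p; rewrite /bracket.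
have D u' w : 'D_w (frame_comb tau u') p = frame_comb tau u' w.
  apply: derive_val; apply: is_derive_linear => k x y.
  exact: frame_comb_linear.
rewrite !D !frame_combE.
by apply: vec4_ext; rewrite !(vec4E, mxE) /=; field.
Qed.

(** The values forced by Koszul's formula from the structure constants. *)
Definition nabla_coef {R : realType} (tau : R) (u v : R * R * R) : R * R * R :=
  let m := tau^-1 * (2 + tau ^+ 2) in
  (tau * (u.1.2 * v.2 - u.2 * v.1.2),
   m * u.1.1 * v.2 + tau * u.2 * v.1.1,
   - m * u.1.1 * v.1.2 - tau * u.1.2 * v.1.1).

Section LeviCivita.
Context {R : realType}.
Variables (tau : R) (nabla : connection_type R).
Hypothesis tau_neq0 : tau != 0.
Hypothesis nablaP : levi_civita tau nabla.
Local Notation fr := (frame_comb tau).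

Lemma nabla_tangent X Y p : vector_field X -> vector_field Y -> SL2 p ->
  lor p (nabla X Y p) = 0.
Proof.
by move=> hX hY; have [_] := conn_field (lc_conn nablaP) hX hY; exact.
Qed.

Lemma g_addl p (x y z : 'cV[R]_4) :
  g tau p (x + y) z = g tau p x z + g tau p y z.
Proof. rewrite /g /lor !mxE; ring. Qed.

Lemma g_oppl p (x z : 'cV[R]_4) : g tau p (- x) z = - g tau p x z.
Proof. rewrite /g /lor !mxE; ring. Qed.

Lemma gC p (x z : 'cV[R]_4) : g tau p x z = g tau p z x.
Proof. rewrite /g /lor; ring. Qed.

(** In Koszul's formula the three derivatives of inner products vanish, as these
    are constant along the hypersurface; only the brackets remain. *)
Lemma koszul_frame u v w p : SL2 p ->
  2 * g tau p (nabla (fr u) (fr v) p) (fr w p)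
  = dot3 (bracket_coef tau u v) w - dot3 (bracket_coef tau v w) u
    + dot3 (bracket_coef tau w u) v.
Proof.
move=> p1.
have F x : vector_field (fr x) by exact: frame_comb_field.
pose k x y z := g tau p (nabla (fr x) (fr y) p) (fr z p).
have M x y z : k x y z = - k x z y.
  have := lc_metric nablaP (F x) (F y) (F z) p1.
  rewrite derive_g_frame ?lor_frame_comb // (gC _ (fr y p)) => /esym/eqP.
  by rewrite addr_eq0 => /eqP.
have T x y z : k x y z = k y x z + dot3 (bracket_coef tau x y) z.
  rewrite -(g_frame_SL2 tau _ _ p) // -bracket_frame //.
  rewrite -(lc_torsion nablaP (F x) (F y) p1) g_addl g_oppl /k; ring.
rewrite -/(k u v w).
have := T u v w; have := M v u w; have := T v w u; have := M w v u.
have := T w u v; have := M u w v; lra.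
Qed.

Lemma nabla_frame u v p : SL2 p ->
  nabla (fr u) (fr v) p = fr (nabla_coef tau u v) p.
Proof.
move=> p1; have F x : vector_field (fr x) by exact: frame_comb_field.
rewrite [LHS](frame_decomp tau p) //; last exact: nabla_tangent.
have half w x : dot3 (bracket_coef tau u v) w - dot3 (bracket_coef tau v w) u
    + dot3 (bracket_coef tau w u) v = 2 * x ->
    g tau p (nabla (fr u) (fr v) p) (fr w p) = x.
  rewrite -(koszul_frame _ _ _ _ p1) => /(mulfI _); apply.
  by rewrite pnatr_eq0.
congr (fr (_, _, _) p); rewrite (E1_frame, E2_frame tau, E3_frame tau);
  by apply: half; rewrite /dot3 /bracket_coef /=; field.
Qed.

(** The inner field agrees with a frame field only on the hypersurface, so the
    independence of [nabla] from the extension is needed to iterate. *)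
Lemma nabla_frame_frame u v w p : SL2 p ->
  nabla (fr u) (nabla (fr v) (fr w)) p
  = fr (nabla_coef tau u (nabla_coef tau v w)) p.
Proof.
move=> p1; have F x : vector_field (fr x) by exact: frame_comb_field.
have fN := conn_field (lc_conn nablaP) (F v) (F w).
have fG := F (nabla_coef tau v w).
rewrite (conn_restr (lc_conn nablaP) (F u) (F u) fN fG) //.
  exact: nabla_frame.
by move=> q; exact: nabla_frame.
Qed.

Lemma frame_extE u p : SL2 p -> frame_ext tau p (fr u p) = fr u.
Proof.
move=> p1; apply/funext => q; rewrite /frame_ext !big_ord_recl big_ord0 addr0.
rewrite /frame /= E1_frame (E2_frame tau) (E3_frame tau).
rewrite !g_frame_SL2 // /dot3 /= -E1_frame -(E2_frame tau) -(E3_frame tau).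
by rewrite !(mulr0, mulr1, addr0, add0r) addrA.
Qed.

Definition curvature_coef (x y z : R * R * R) : R * R * R :=
  nabla_coef tau x (nabla_coef tau y z) - nabla_coef tau y (nabla_coef tau x z)
  - nabla_coef tau (bracket_coef tau x y) z.

Lemma curvature_atE x y z p : SL2 p ->
  curvature_at tau nabla p (fr x p) (fr y p) (fr z p)
  = fr (curvature_coef x y z) p.
Proof.
move=> p1; rewrite /curvature_at !frame_extE // /curvature.
rewrite bracket_frame // !nabla_frame_frame // nabla_frame //.
rewrite /frame_comb /curvature_coef /=.
by apply: vec4_ext; rewrite !mxE; ring.
Qed.

End LeviCivita.

(** * Covariant derivatives along the curve *)
Lemma is_derive0_interval {R : realType} (I : set R) (f : R -> R) s t :
  is_interval I -> (forall x, I x -> is_derive x 1 (f : R -> R^o) 0) ->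
  I s -> I t -> f s = f t.
Proof.
move=> itI df Is It.
wlog st : s t Is It / s <= t.
  by move=> W; have [/W -> //|/ltW/W ->] := leP s t.
have sub x : x \in `[s, t]%R -> I x.
  by rewrite in_itv /= => xst; exact: itI Is It _ xst.
have df' x : x \in `]s, t[%R -> is_derive x 1 (f : R -> R^o) 0.
  by move=> xst; apply/df/sub/subset_itv_oo_cc.
have cf : {within [set` `[s, t]%R], continuous (f : R -> R^o)}.
  apply: derivable_within_continuous => x xst.
  by have [] := df x (sub x xst).
have [x _] := @MVT_segment R f (fun=> 0) s t st df' cf.
by rewrite mul0r => /eqP; rewrite subr_eq0 => /eqP ->.
Qed.

Lemma cov_deriv_frame {R : realType} (tau : R) (nabla : connection_type R)
    (I : set R) (gam V : R -> 'cV[R]_4) (v1 v2 v3 : R -> R) (s : R) T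
    (d1 d2 d3 : R) :
  tau != 0 -> levi_civita tau nabla -> open I ->
  (forall t, I t -> SL2 (gam t)) ->
  (forall t, I t -> V t = frame_comb tau (v1 t, v2 t, v3 t) (gam t)) ->
  I s -> derive1 gam s = frame_comb tau T (gam s) ->
  is_derive s 1 (v1 : R -> R^o) d1 -> is_derive s 1 (v2 : R -> R^o) d2 ->
  is_derive s 1 (v3 : R -> R^o) d3 ->
  cov_deriv tau nabla gam V s
  = frame_comb tau ((d1, d2, d3) + nabla_coef tau T (v1 s, v2 s, v3 s)) (gam s).
Proof.
move=> t0 nablaP oI SI VE Is gE D1 D2 D3.
have nI : \forall t \near s, I t by exact: open_nbhs_nbhs.
have p1 := SI s Is.
have coord e (f : R -> R) d : is_derive s 1 (f : R -> R^o) d ->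
    (forall t, dot3 (v1 t, v2 t, v3 t) e = f t) ->
    rderiv (fun t => g tau (gam t) (V t) (frame_comb tau e (gam t))) s = d.
  move=> df fE; rewrite /rderiv derive1E -(derive_val (is_derive := df)).
  apply: near_eq_derive; near=> t.
  have It : I t by near: t.
  by rewrite VE // g_frame_SL2 ?fE //; exact: SI.
rewrite /cov_deriv !big_ord_recl big_ord0 addr0 /frame /=.
rewrite E1_frame (E2_frame tau) (E3_frame tau).
rewrite (coord _ _ _ D1) => [|t]; last by rewrite /dot3 /=; ring.
rewrite (coord _ _ _ D2) => [|t]; last by rewrite /dot3 /=; ring.
rewrite (coord _ _ _ D3) => [|t]; last by rewrite /dot3 /=; ring.
rewrite gE (VE s Is) frame_extE // !nabla_frame // !g_frame_SL2 //.
rewrite /frame_comb /nabla_coef /dot3 /=.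
by apply: vec4_ext; rewrite !mxE; ring.
Unshelve. all: by end_near. Qed.

(** Used to read off one scalar component of a vanishing vector. *)
Lemma frame_comb_eq0 {R : realType} (tau : R) u w q : tau != 0 -> SL2 q ->
  frame_comb tau u q = 0 -> dot3 u w = 0.
Proof.
move=> t0 q1 u0; rewrite -(g_frame_SL2 tau _ _ q) // u0.
by rewrite /g /lor !mxE; ring.
Qed.

(** * Biharmonicity forces a constant angular speed *)
Section ConstantAngle.
Context {R : realType}.
Variables (tau : R) (nabla : connection_type R).
Variables (I : set R) (gam : R -> 'cV[R]_4) (theta : R) (beta : R -> R).
Hypothesis tau_gt0 : 0 < tau.
Hypothesis nablaP : levi_civita tau nabla.
Hypothesis gamP : curve I gam.
Hypothesis beta_smooth : smooth_on I (beta : R -> R^o).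
Hypothesis gam' : forall s, I s ->
  derive1 gam s = cos theta *: E1 tau (gam s)
              + (sin theta * sin (beta s)) *: E2 (gam s)
              + (sin theta * cos (beta s)) *: E3 (gam s).

Local Notation c := (cos theta).
Local Notation S := (sin theta).
Local Notation fr := (frame_comb tau).

Let B n : R -> R := derive1n n (beta : R -> R^o).
Let Cb : R -> R := cos \o beta.
Let Sb : R -> R := sin \o beta.
(** The signed geodesic curvature of the curve. *)
Let kap : R -> R := fun t => S * (B 1 t + 2 * tau^-1 * (1 + tau ^+ 2) * c).
Let kap1 : R -> R := fun t => S * B 2 t.
Let kap2 : R -> R := fun t => S * B 3 t.
Let mc : R := tau^-1 * (2 + tau ^+ 2) * c.

Let tau_neq0 : tau != 0. Proof. exact: lt0r_neq0. Qed.

Let openI : open I. Proof. by case: gamP. Qed.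
Let onSL2 s : I s -> SL2 (gam s). Proof. by case: gamP => _ _ _; exact. Qed.

Let dB n s : I s -> is_derive s 1 (B n : R -> R^o) (B n.+1 s).
Proof.
move=> Is; rewrite /B derive1nS derive1E; apply: derivableP.
exact: beta_smooth.
Qed.

Let dCb s : I s -> is_derive s 1 (Cb : R -> R^o) (- Sb s * B 1 s).
Proof. by move=> Is; have := dB 0 s Is => ?; exact: is_derive1_comp. Qed.

Let dSb s : I s -> is_derive s 1 (Sb : R -> R^o) (Cb s * B 1 s).
Proof. by move=> Is; have := dB 0 s Is => ?; exact: is_derive1_comp. Qed.

Let dB1c s k : I s -> is_derive s 1 (fun t => B 1 t + k : R^o) (B 2 s).
Proof.
move=> /(dB 1) dBs.
have : is_derive s 1 ((B 1 : R -> R^o) + cst k) (B 2 s).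
  by apply: is_derive_eq; rewrite addr0.
by [].
Qed.

Let dK s : I s -> is_derive s 1 (kap : R -> R^o) (kap1 s).
Proof. by move=> Is; exact: (is_deriveZ S (dB1c s _ Is)). Qed.

Let dK1 s : I s -> is_derive s 1 (kap1 : R -> R^o) (kap2 s).
Proof. by move=> Is; exact: (is_deriveZ S (dB 2 s Is)). Qed.

Let T s : R * R * R := (c, S * Sb s, S * Cb s).
(** Frame coefficients of the first three covariant derivatives of the unit
    tangent [T]. *)
Let DT s : R * R * R := (0, kap s * Cb s, - (kap s * Sb s)).
Let DDT s : R * R * R :=
  (- (tau * S) * kap s,
   kap1 s * Cb s - kap s * (B 1 s + mc) * Sb s,
   - (kap1 s * Sb s) - kap s * (B 1 s + mc) * Cb s).
Let DDDT s : R * R * R :=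
  (- (tau * S) * kap1 s,
   kap2 s * Cb s - kap1 s * (B 1 s) * Sb s
   - (kap1 s * (B 1 s + mc) * Sb s + kap s * B 2 s * Sb s
      + kap s * (B 1 s + mc) * Cb s * B 1 s),
   - (kap2 s * Sb s + kap1 s * (B 1 s) * Cb s)
   - (kap1 s * (B 1 s + mc) * Cb s + kap s * B 2 s * Cb s
      - kap s * (B 1 s + mc) * Sb s * B 1 s))
  + nabla_coef tau (T s) (DDT s).

Let gam'E s : I s -> derive1 gam s = fr (T s) (gam s).
Proof. exact: gam'. Qed.

Lemma cov_deriv_T s : I s ->
  cov_deriv tau nabla gam (derive1 gam) s = fr (DT s) (gam s).
Proof.
move=> Is; have hC := dCb s Is; have hS := dSb s Is.
rewrite (@cov_deriv_frame R tau nabla I gam _ (cst c) (S *: (Sb : R -> R^o))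
  (S *: (Cb : R -> R^o)) s (T s) 0 (S * (Cb s * B 1 s))
  (S * (- Sb s * B 1 s))) //; last 1 first.
- exact: gam'E.
congr (fr _ _); rewrite /DT /nabla_coef /T /kap.
by congr (_, _, _) => /=; rewrite ?fctE /GRing.scale /=; field.
Qed.

Lemma cov_deriv_DT s V : (forall t, I t -> V t = fr (DT t) (gam t)) -> I s ->
  cov_deriv tau nabla gam V s = fr (DDT s) (gam s).
Proof.
move=> VE Is.
have hC := dCb s Is; have hS := dSb s Is; have hK := dK s Is.
rewrite (@cov_deriv_frame R tau nabla I gam _ (cst 0)
  ((kap : R -> R^o) * (Cb : R -> R^o))
  (- ((kap : R -> R^o) * (Sb : R -> R^o))) s (T s) 0
  (kap s * (- Sb s * B 1 s) + Cb s * kap1 s)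
  (- (kap s * (Cb s * B 1 s) + Sb s * kap1 s))) //; last 1 first.
- exact: gam'E.
congr (fr _ _); rewrite /DDT /nabla_coef /T /mc.
congr (_, _, _) => /=; rewrite ?fctE; last by field.
- have cs := cos2Dsin2 (beta s); rewrite -[Cb s]/(cos _) -[Sb s]/(sin _).
  transitivity (- (tau * S) * kap s * (cos (beta s) ^+ 2 + sin (beta s) ^+ 2)).
    by ring.
  by rewrite cs mulr1.
- by field.
Qed.

Lemma cov_deriv_DDT s V : (forall t, I t -> V t = fr (DDT t) (gam t)) -> I s ->
  cov_deriv tau nabla gam V s = fr (DDDT s) (gam s).
Proof.
move=> VE Is.
have hC := dCb s Is; have hS := dSb s Is; have hK := dK s Is.
have hK1 := dK1 s Is; have hB := dB1c s mc Is.
pose Bm : R -> R^o := fun t => B 1 t + mc.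
have hB' : is_derive s 1 Bm (B 2 s) by exact: hB.
have d1 := is_deriveZ (- (tau * S)) hK.
have d2 : is_derive s 1
    ((kap1 : R -> R^o) * (Cb : R -> R^o)
     - (kap : R -> R^o) * Bm * (Sb : R -> R^o))
    (DDDT s - nabla_coef tau (T s) (DDT s)).1.2.
  apply: is_derive_eq (is_deriveB (is_deriveM hK1 hC)
    (is_deriveM (is_deriveM hK hB') hS)) _.
  by rewrite /DDDT addrK /Bm /= !fctE /GRing.scale /=; ring.
have d3 : is_derive s 1
    (- ((kap1 : R -> R^o) * (Sb : R -> R^o))
     - (kap : R -> R^o) * Bm * (Cb : R -> R^o))
    (DDDT s - nabla_coef tau (T s) (DDT s)).2.
  apply: is_derive_eq (is_deriveB (is_deriveN (is_deriveM hK1 hS))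
    (is_deriveM (is_deriveM hK hB') hC)) _.
  by rewrite /DDDT addrK /Bm /= !fctE /GRing.scale /=; ring.
rewrite (cov_deriv_frame _ _ _ _ _ _ _ _ _ _ _ _ _ tau_neq0 nablaP openI
  onSL2 VE Is (gam'E s Is) d1 d2 d3).
by rewrite /DDDT addrK.
Qed.

Lemma bitension_coord s w : I s -> bitension tau nabla gam s = 0 ->
  dot3 (DDDT s - curvature_coef tau (T s) (DT s) (T s)) w = 0.
Proof.
move=> Is; rewrite /bitension.
rewrite (cov_deriv_DDT s _ _ Is); last first.
  by move=> t It; apply: cov_deriv_DT => // x; exact: cov_deriv_T.
rewrite gam'E // cov_deriv_T // curvature_atE //; last exact: onSL2.
move=> h; apply: (frame_comb_eq0 tau _ _ (gam s)) => //; first exact: onSL2.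
rewrite -h /frame_comb /=.
by apply: vec4_ext; rewrite !mxE; ring.
Qed.

(** The curvature term is orthogonal to [T], so the tangential part is that of
    the third covariant derivative alone, as for any curve in a Riemannian
    manifold. *)
Lemma bitension_T s : I s -> bitension tau nabla gam s = 0 ->
  kap s * kap1 s = 0.
Proof.
move=> Is /(bitension_coord s (T s) Is).
have e1 : Cb s ^+ 2 + Sb s ^+ 2 = 1 by exact: cos2Dsin2.
suff -> : dot3 (DDDT s - curvature_coef tau (T s) (DT s) (T s)) (T s)
    = -3 * (kap s * kap1 s).
  by move/eqP; rewrite mulf_eq0 => /orP[|/eqP //]; rewrite oppr_eq0 pnatr_eq0.
(* The dependence on beta is through cos^2 + sin^2 only. *)
have -> : dot3 (DDDT s - curvature_coef tau (T s) (DT s) (T s)) (T s)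
    = - (c * tau * S * kap1 s)
      - S * (2 * kap1 s * B 1 s + 2 * kap1 s * mc + kap s * B 2 s
             + tau * c * kap1 s)
        * (Cb s ^+ 2 + Sb s ^+ 2).
  rewrite /dot3 /DDDT /DDT /curvature_coef /DT /T /nabla_coef /bracket_coef.
  rewrite /mc /=.
  generalize (Sb s) (Cb s) (kap s) (kap1 s) (kap2 s) (B 1 s) (B 2 s) S c.
  by move=> y x k k1 k2 b1 b2 d e; ring.
by rewrite e1 /kap /kap1 /mc; field.
Qed.

(** With constant curvature kappa and torsion, the part along the principal
    normal is kappa (K - kappa^2 - torsion^2), where
    K = tau^2 - 4 (1 + tau^2) sin^2 theta is the sectional curvature of the
    osculating plane; completing the square in b gives the stated form. *)
Lemma bitension_N s : I s -> B 2 s = 0 -> B 3 s = 0 -> kap s != 0 ->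
  bitension tau nabla gam s = 0 ->
  (B 1 s + tau^-1 * (2 + tau ^+ 2) * c) ^+ 2
  = (4 + 5 * tau ^+ 2) * c ^+ 2 - 4 * (1 + tau ^+ 2).
Proof.
move=> Is B2 B3 K0 /(bitension_coord s (0, Cb s, - Sb s) Is).
have e1 : Cb s ^+ 2 + Sb s ^+ 2 = 1 by exact: cos2Dsin2.
have e2 : S ^+ 2 = 1 - c ^+ 2 by exact: sin2cos2.
have -> : dot3 (DDDT s - curvature_coef tau (T s) (DT s) (T s))
    (0, Cb s, - Sb s)
   = - kap s * ((Cb s ^+ 2 + Sb s ^+ 2)
              * ((B 1 s + mc) ^+ 2 + tau ^+ 2 * S ^+ 2 - tau ^+ 2 * c ^+ 2)
              + (Cb s ^+ 2 + Sb s ^+ 2) ^+ 2 * S ^+ 2 * (4 + 3 * tau ^+ 2)).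
  rewrite /dot3 /DDDT /DDT /curvature_coef /DT /T /nabla_coef /bracket_coef.
  rewrite /mc /= /kap1 /kap2 B2 B3.
  generalize (Sb s) (Cb s) (kap s) (B 1 s) S c.
  by move=> y x k b1 d e; field.
rewrite e1 expr1n !mul1r e2 => /eqP; rewrite mulf_eq0 oppr_eq0 (negbTE K0) /=.
move=> /eqP h; apply/eqP; rewrite -subr_eq0 -h /mc; apply/eqP; ring.
Qed.

Hypothesis sin_gt0 : 0 < S.
Hypothesis gam_bih : proper_biharmonic tau nabla I gam.

Lemma proper_biharmonic_angle : exists b, [/\ exists s0, I s0,
  forall s, I s -> rderiv beta s = b
  & (b + tau^-1 * (2 + tau ^+ 2) * c) ^+ 2
    = (4 + 5 * tau ^+ 2) * c ^+ 2 - 4 * (1 + tau ^+ 2)].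
Proof.
have [bih /existsNP[s0 /not_implyP[Is0 ngeo]]] := gam_bih.
have itI : is_interval I by case: gamP.
have K0 : kap s0 != 0.
  apply/eqP => K0; apply: ngeo; rewrite cov_deriv_T // /DT K0 /frame_comb /=.
  by rewrite !mul0r oppr0 !scale0r !addr0.
have KK s : I s -> kap s * kap s = kap s0 * kap s0.
  move=> Is; apply: (is_derive0_interval I (fun t => kap t * kap t)) => // x Ix.
  have dKx := dK x Ix.
  have : is_derive x 1 ((kap : R -> R^o) * (kap : R -> R^o)) 0.
    apply: is_derive_eq; rewrite /GRing.scale /= (bitension_T x Ix (bih x Ix)).
    by rewrite addr0.
  by [].
have Kn0 s : I s -> kap s != 0.
  move=> Is; apply/eqP => Ks0; have := KK s Is; rewrite Ks0 mulr0 => /esym/eqP.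
  by rewrite mulf_eq0 orbb (negbTE K0).
have B2 s : I s -> B 2 s = 0.
  move=> Is; have /eqP := bitension_T s Is (bih s Is).
  by rewrite mulf_eq0 (negbTE (Kn0 s Is)) /kap1 mulf_eq0 gt_eqF //= => /eqP.
have B3 s : I s -> B 3 s = 0.
  move=> Is; rewrite -(derive_val (is_derive := dB 2 s Is)).
  rewrite -(derive_cst (V := R^o) (0 : R^o) s 1); apply: near_eq_derive.
  have nI : \forall t \near s, I t by exact: open_nbhs_nbhs.
  by near=> t; apply: B2; near: t.
exists (B 1 s0); split; first by exists s0.
- move=> s Is; apply: (is_derive0_interval I (B 1) s s0) => // x Ix.
  by rewrite -(B2 x Ix); exact: dB.
- exact: (bitension_N s0 Is0 (B2 _ Is0) (B3 _ Is0) K0 (bih _ Is0)).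
Unshelve. all: by end_near. Qed.

End ConstantAngle.

(** * The constants of the biharmonic helix *)
Lemma sin_cos_sign {R : realType} (theta : R) :
  0 < theta -> theta <= pi / 2 -> 0 < sin theta /\ 0 <= cos theta.
Proof.
move=> t0 t1; have pi0 := pi_gt0 R; split.
  by apply: sin_gt0_pi; rewrite t0; lra.
by apply: cos_ge0_pihalf; apply/andP; split; lra.
Qed.

Lemma acoefE {R : realType} (tau theta b : R) : acoef tau theta b
  = sin theta ^+ 2 - (tau^-1 * cos theta) ^+ 2 - tau^-1 * cos theta * b.
Proof.
rewrite sin2cos2 /acoef mulr_natl cos_mulr2n -exprVn -mulr_natl.
by generalize tau^-1 => t; field.
Qed.

(** Throughout, [q] is the quantity whose square is prescribed by [bE], and [D]
    is the square root of the discriminant, so that the frequencies are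
    (- b + D) / 2 and (- b - D) / 2. *)
Section Constants.
Context {R : realType}.
Variables (tau c b a S t : R).
Hypothesis tau_gt0 : 0 < tau.
Hypothesis c_ge0 : 0 <= c.
Hypothesis S_gt0 : 0 < S.
Hypothesis cS : c ^+ 2 + S ^+ 2 = 1.
Hypothesis tE : t = tau^-1.
Hypothesis aE : a = S ^+ 2 - (t * c) ^+ 2 - t * c * b.
Hypothesis b2_gt4a : 4 * a < b ^+ 2.
Hypothesis bE : (b + t * (2 + tau ^+ 2) * c) ^+ 2
  = (4 + 5 * tau ^+ 2) * c ^+ 2 - 4 * (1 + tau ^+ 2).

Local Notation q := (b + t * (2 + tau ^+ 2) * c).
Local Notation D := (Num.sqrt (b ^+ 2 - 4 * a)).

Let tau2 : 0 < tau ^+ 2. Proof. exact: exprn_gt0. Qed.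
Let S2E : S ^+ 2 = 1 - c ^+ 2. Proof. by rewrite -cS addrC addKr. Qed.
Let taut : tau * t = 1. Proof. by rewrite tE mulfV // lt0r_neq0. Qed.
Let t_gt0 : 0 < t. Proof. by rewrite tE invr_gt0. Qed.

Lemma cos2_ge : 4 * (1 + tau ^+ 2) / (4 + 5 * tau ^+ 2) <= c ^+ 2.
Proof.
rewrite ler_pdivrMr; last by have := tau2; lra.
by rewrite [leRHS]mulrC -subr_ge0 -bE sqr_ge0.
Qed.

Let c_gt0 : 0 < c.
Proof.
rewrite lt0r c_ge0 andbT; apply/eqP => c0; have := sqr_ge0 q.
rewrite bE c0 expr0n /= mulr0 sub0r oppr_ge0 leNgt.
by move/negP; apply; have := tau2; lra.
Qed.

Let q_lt : q < c * tau.
Proof.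
have h : q ^+ 2 = (c * tau) ^+ 2 - 4 * S ^+ 2 * (1 + tau ^+ 2).
  by rewrite bE S2E; ring.
have hc : 0 < c * tau by exact: mulr_gt0.
have hS : 0 < S ^+ 2 * (1 + tau ^+ 2).
  by rewrite mulr_gt0 ?exprn_gt0 // addr_gt0.
rewrite ltNge; apply/negP => hq.
have : (c * tau) ^+ 2 <= q ^+ 2.
  by rewrite lerXn2r ?nnegrE // ltW // (lt_le_trans hc).
lra.
Qed.

Let b2tc : - b - 2 * (t * c) = c * tau - q.
Proof. have e : t * tau = 1 by rewrite mulrC. ring: e. Qed.

(** The discriminant is also that of the first-order system solved by the
    curve, b^2 - 4 a = (b + 2 t c)^2 - 4 S^2. *)
Let sqrD_q : D ^+ 2 = (c * tau - q) ^+ 2 - 4 * S ^+ 2.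
Proof. by rewrite sqr_sqrtr ?subr_ge0 ?ltW // -b2tc aE; ring. Qed.

Lemma sqrt_disc_gt0 : 0 < D.
Proof. by rewrite sqrtr_gt0 subr_gt0. Qed.

(** This bound carries all the sign conditions: it gives b < 0 and places t c
    below the smaller frequency, which makes C11 negative and C33 positive. *)
Lemma sqrt_disc_lt : D < - b - 2 * (t * c).
Proof.
have S2 : 0 < S ^+ 2 by exact: exprn_gt0.
have := sqrD_q; have := q_lt; have := sqrt_disc_gt0; rewrite b2tc.
set x := c * tau - q => D0 qlt sqrD; have x0 : 0 < x by rewrite subr_gt0.
rewrite ltNge; apply/negP => hx.
have : x ^+ 2 <= D ^+ 2 by rewrite lerXn2r ?nnegrE ?(ltW x0) ?(ltW D0).
by rewrite sqrD; lra.
Qed.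

Lemma neg_b_gt0 : 0 < - b.
Proof.
have := sqrt_disc_lt; have := sqrt_disc_gt0.
have : 0 < t * c by exact: mulr_gt0.
lra.
Qed.

(** Positivity of the discriminant reads c tau q < L with L as below; for
    q >= 0 both sides may be squared, and L^2 - (c tau q)^2 has the factor
    S^2 = 1 - c^2 > 0, which leaves the claimed bound. *)
Lemma cos2_lt : 0 <= q ->
  c ^+ 2 < (2 + tau ^+ 2) ^+ 2 / (4 + 5 * tau ^+ 2 + tau ^+ 4).
Proof.
move=> q0; have tau4 : 0 < tau ^+ 4 by exact: exprn_gt0.
have S2 : 0 < S ^+ 2 by exact: exprn_gt0.
rewrite ltr_pdivlMr; last by have := tau2; lra.
pose L := c ^+ 2 * (4 + 3 * tau ^+ 2) - 4 - 2 * tau ^+ 2.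
have LE : 2 * L - 2 * (c * tau * q) = D ^+ 2.
  by rewrite sqrD_q sqrrB bE S2E /L; ring.
have D20 : 0 < D ^+ 2 by rewrite exprn_gt0 ?sqrt_disc_gt0.
have cq : 0 <= c * tau * q by rewrite !mulr_ge0 // ltW.
have : (c * tau * q) ^+ 2 < L ^+ 2 by rewrite ltrXn2r ?nnegrE //; lra.
rewrite exprMn bE -subr_gt0.
have -> : L ^+ 2 - (c * tau) ^+ 2
      * ((4 + 5 * tau ^+ 2) * c ^+ 2 - 4 * (1 + tau ^+ 2))
    = 4 * (S ^+ 2 * ((2 + tau ^+ 2) ^+ 2
                     - c ^+ 2 * (4 + 5 * tau ^+ 2 + tau ^+ 4))).
  by rewrite S2E /L; ring.
by rewrite pmulr_rgt0 // pmulr_rgt0 // subr_gt0.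
Qed.

Lemma sqrt_b2D : Num.sqrt (b ^+ 2 * (b ^+ 2 - 4 * a)) = - b * D.
Proof.
by rewrite sqrtrM ?sqr_ge0 // sqrtr_sqr -normrN gtr0_norm ?neg_b_gt0.
Qed.

Let sqrD : D ^+ 2 = b ^+ 2 - 4 * a.
Proof. by rewrite sqr_sqrtr // subr_ge0 ltW. Qed.

Lemma alpha1_sqr : (b ^+ 2 - 2 * a + - b * D) / 2 = ((- b + D) / 2) ^+ 2.
Proof.
move: sqrD; generalize D => d dE.
have -> : a = (b ^+ 2 - d ^+ 2) / 4 by rewrite dE; field.
by field.
Qed.

Lemma alpha2_sqr : (b ^+ 2 - 2 * a - - b * D) / 2 = ((- b - D) / 2) ^+ 2.
Proof.
move: sqrD; generalize D => d dE.
have -> : a = (b ^+ 2 - d ^+ 2) / 4 by rewrite dE; field.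
by field.
Qed.

Lemma alpha1E : alpha1 a b = (- b + D) / 2.
Proof.
have b0 := neg_b_gt0; have D0 := sqrt_disc_gt0.
by rewrite /alpha1 sqrt_b2D alpha1_sqr sqrtr_sqr ger0_norm //; lra.
Qed.

Lemma alpha2E : alpha2 a b = (- b - D) / 2.
Proof.
have tc : 0 < t * c by exact: mulr_gt0.
have lt := sqrt_disc_lt; have D0 := sqrt_disc_gt0.
by rewrite /alpha2 sqrt_b2D alpha2_sqr sqrtr_sqr ger0_norm //; lra.
Qed.

Lemma alpha_roots :
  [/\ alpha1 a b + alpha2 a b = - b, alpha1 a b * alpha2 a b = a,
      t * c < alpha2 a b & alpha2 a b < alpha1 a b].
Proof.
have lt := sqrt_disc_lt; have D0 := sqrt_disc_gt0.
rewrite alpha1E alpha2E; split; [by field| |lra|lra].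
move: sqrD; generalize D => d dE.
have -> : a = (b ^+ 2 - d ^+ 2) / 4 by rewrite dE; field.
by field.
Qed.

End Constants.

(** In terms of the frequencies, [Btilde] factors so that the quotients defining
    [C11] and [C33] simplify. *)
Lemma BtildeE {R : realType} (tau theta b a1 a2 : R) : a1 + a2 = - b ->
  a1 * a2 = acoef tau theta b ->
  Btilde tau theta = tau^-1 * cos theta * (a1 + a2) - a1 * a2.
Proof. by move=> -> ->; rewrite acoefE sin2cos2 /Btilde -exprVn; ring. Qed.

Lemma C33E {R : realType} (tau theta b : R) (a := acoef tau theta b)
    (a1 := alpha1 a b) (a2 := alpha2 a b) :
  a1 + a2 = - b -> a1 * a2 = a -> a1 + a2 != 0 -> a1 - a2 != 0 ->
  C33 tau theta a b = (a1 - tau^-1 * cos theta) / (a1 - a2).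
Proof.
move=> sE pE s0 d0; rewrite /C33 (BtildeE _ _ _ _ _ sE pE) subr_sqr.
rewrite -/a1 -/a2; move: s0 d0; generalize (tau^-1 * cos theta) a1 a2.
by move=> x y z s0 d0; field; rewrite s0 d0.
Qed.

Lemma C11E {R : realType} (tau theta b : R) (a := acoef tau theta b)
    (a1 := alpha1 a b) (a2 := alpha2 a b) :
  a1 + a2 = - b -> a1 * a2 = a -> a1 + a2 != 0 -> a1 - a2 != 0 ->
  - C11 tau theta a b = (a2 - tau^-1 * cos theta) / (a1 - a2).
Proof.
move=> sE pE s0 d0; rewrite /C11 (BtildeE _ _ _ _ _ sE pE) subr_sqr.
rewrite -/a1 -/a2; move: s0 d0; generalize (tau^-1 * cos theta) a1 a2.
by move=> x y z s0 d0; field; rewrite s0 d0.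
Qed.

(** * Linear algebra of the indefinite form *)
Lemma sum4 (R : nzRingType) (F : 'I_4 -> R) :
  \sum_(i < 4) F i = F 0 + F 1 + F 2 + F 3.
Proof.
rewrite !big_ord_recl big_ord0 addr0 !addrA.
by congr (F _ + F _ + F _ + F _); apply: val_inj.
Qed.

Lemma J1_mul {R : realType} (v : 'cV[R]_4) : J1 *m v = X1 v.
Proof.
have J1E (i j : 'I_4) : (J1 : 'M[R]_4) i j =
    nth 0 (nth [::] [:: [:: 0; -1; 0; 0]; [:: 1; 0; 0; 0];
                        [:: 0; 0; 0; -1]; [:: 0; 0; 1; 0]] i) j.
  rewrite /J1 /block_mx mxE; case: splitP => k hk; rewrite mxE;
    case: splitP => l hl; rewrite ?mxE /= hk hl;
    by case: k {hk} => [[|[|k]] hk] //; case: l {hl} => [[|[|l]] hl].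
rewrite X1E; apply: vec4_ext; rewrite vec4E mxE sum4 !J1E /=.
all: by rewrite ?(mul0r, mul1r, mulN1r, add0r, addr0).
Qed.

Definition of_cols {R : realType} (u1 u2 u3 u4 : 'cV[R]_4) : 'M[R]_4 :=
  \matrix_(i, j) nth 0 [:: u1 i 0; u2 i 0; u3 i 0; u4 i 0] j.

Lemma of_cols_mul {R : realType} (u1 u2 u3 u4 : 'cV[R]_4) a b c d :
  of_cols u1 u2 u3 u4 *m vec4 a b c d
  = a *: u1 + b *: u2 + c *: u3 + d *: u4.
Proof.
apply/matrixP => i j; rewrite (ord1 j) !mxE sum4 !mxE /=; ring.
Qed.

Lemma X1_lin {R : realType} (k l : R) (u v : 'cV[R]_4) :
  X1 (k *: u + l *: v) = k *: X1 u + l *: X1 v.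
Proof. rewrite !X1E; apply: vec4_ext; rewrite !(vec4E, mxE); ring. Qed.

Lemma lor_X1 {R : realType} (u v : 'cV[R]_4) : lor (X1 u) (X1 v) = lor u v.
Proof. rewrite !X1E /lor !vec4E; ring. Qed.

Lemma lorC {R : realType} (u v : 'cV[R]_4) : lor u v = lor v u.
Proof. rewrite /lor; ring. Qed.

Lemma lor_X1l {R : realType} (u v : 'cV[R]_4) : lor (X1 u) v = - lor u (X1 v).
Proof. rewrite !X1E /lor !vec4E; ring. Qed.

Lemma lorZl {R : realType} k (u v : 'cV[R]_4) : lor (k *: u) v = k * lor u v.
Proof. rewrite /lor !mxE; ring. Qed.

Lemma lorZr {R : realType} k (u v : 'cV[R]_4) : lor u (k *: v) = k * lor u v.
Proof. by rewrite lorC lorZl lorC. Qed.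

Lemma lor_self_X1 {R : realType} (u : 'cV[R]_4) : lor u (X1 u) = 0.
Proof. rewrite X1E /lor !vec4E; ring. Qed.

(** The entries of A^T eps A are the products of the columns of A. *)
Lemma lor_mx {R : realType} (A B : 'M[R]_4) i j :
  (A^T *m (eps *m B)) i j = lor (col i A) (col j B).
Proof. rewrite mxE sum4 /eps mul_diag_mx /lor !mxE /=; ring. Qed.

Lemma col_of_cols {R : realType} (u1 u2 u3 u4 : 'cV[R]_4) j :
  col j (of_cols u1 u2 u3 u4) = nth 0 [:: u1; u2; u3; u4] j.
Proof.
apply/matrixP => i k; rewrite (ord1 k) !mxE.
by case: j => [[|[|[|[|j]]]] hj].
Qed.

Lemma lorNl {R : realType} (u v : 'cV[R]_4) : lor (- u) v = - lor u v.
Proof. rewrite /lor !mxE; ring. Qed.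

(** The two orthogonality conditions say that u and v are orthogonal for the
    Hermitian form whose real part is [lor].  An antilinear map sending the
    first and third basis vectors to u and v must send the second and fourth,
    their images under [X1], to - X1 u and - X1 v. *)
Lemma O2_4_anticommuting {R : realType} (u v : 'cV[R]_4) :
  lor u u = 1 -> lor v v = -1 -> lor u v = 0 -> lor u (X1 v) = 0 ->
  let A := of_cols u (- X1 u) v (- X1 v) in
  O2_4 A /\ J1 *m A = - (A *m J1).
Proof.
move=> uu vv uv uXv A.
have eps2 : (eps : 'M[R]_4) *m eps = 1%:M.
  rewrite /eps mul_diag_mx; apply/matrixP => i j; rewrite !mxE.
  case: i => [[|[|[|[|i]]]] hi]; case: j => [[|[|[|[|j]]]] hj] //=;
    by rewrite ?mulr1n ?mulr0n ?mulr0 ?mulrNN ?mulr1.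
have orth : A^T *m (eps *m A) = eps.
  apply/matrixP => i j; rewrite lor_mx !col_of_cols !mxE.
  have vu : lor v u = 0 by rewrite lorC.
  have uXu := lor_self_X1 u; have vXv := lor_self_X1 v.
  have vXu : lor v (X1 u) = 0 by rewrite lorC lor_X1l uXv oppr0.
  case: i => [[|[|[|[|i]]]] hi]; case: j => [[|[|[|[|j]]]] hj] //=;
    rewrite ?lorNl ?(lorC _ (- _)) ?lorNl ?lor_X1 ?lor_X1l;
    by rewrite ?(uu, vv, uv, vu, uXv, vXu, uXu, vXv) ?mulr1n ?mulr0n
      ?(opprK, oppr0).
have invA : (eps *m A^T *m eps) *m A = 1%:M by rewrite -!mulmxA orth.
have Au : A \in unitmx by have [] := mulmx1_unit invA.
split.
  split=> //; have -> : invmx A = eps *m A^T *m eps.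
    by rewrite -[RHS]mulmx1 -(mulmxV Au) mulmxA invA mul1mx.
  by rewrite -!mulmxA eps2 mulmx1 mulmxA eps2 mul1mx.
have ext (B C : 'M[R]_4) : (forall x, B *m x = C *m x :> 'cV[R]_4) -> B = C.
  by move=> BC; apply/trmx_inj/row_matrixP => i; rewrite -!tr_col !colE BC.
apply: ext => x.
have xE : x = vec4 (x 0 0) (x 1 0) (x 2 0) (x 3 0).
  by apply: vec4_ext; rewrite vec4E.
rewrite mulNmx -!mulmxA !J1_mul xE [X1 (vec4 _ _ _ _)]X1E !vec4E /A.
rewrite !of_cols_mul !X1E.
apply: vec4_ext; rewrite !(vec4E, mxE); ring.
Qed.

(** * Splitting the curve into two uniform rotations *)

(** A point moving on a circle at constant speed is fixed in the co-rotating
    frame: the two combinations have zero derivative. *)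
Lemma rotating_pair {R : realType} (I : set R) (al : R) (f h : R -> R) s s0 :
  is_interval I ->
  (forall x, I x -> is_derive x 1 (f : R -> R^o) (al * h x)) ->
  (forall x, I x -> is_derive x 1 (h : R -> R^o) (- al * f x)) ->
  I s -> I s0 ->
  cos (al * s) * f s - sin (al * s) * h s
  = cos (al * s0) * f s0 - sin (al * s0) * h s0 /\
  cos (al * s) * h s + sin (al * s) * f s
  = cos (al * s0) * h s0 + sin (al * s0) * f s0.
Proof.
move=> itI df dh Is Is0.
pose M : R -> R := al \*: id.
have dM (x : R) : is_derive x 1 (M : R -> R^o) al.
  by apply: is_derive_eq; rewrite /GRing.scale /= mulr1.
pose Cf : R -> R := cos \o M; pose Sf : R -> R := sin \o M.
have dC (x : R) : is_derive x 1 (Cf : R -> R^o) (- sin (al * x) * al).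
  exact: is_derive1_comp.
have dS (x : R) : is_derive x 1 (Sf : R -> R^o) (cos (al * x) * al).
  exact: is_derive1_comp.
split.
- apply: (is_derive0_interval I (fun x => Cf x * f x - Sf x * h x)) => // x Ix.
  have dfx := df x Ix; have dhx := dh x Ix.
  apply: is_derive_eq (is_deriveB (is_deriveM (dC x) dfx)
    (is_deriveM (dS x) dhx)) _.
  by rewrite /Cf /Sf /M /GRing.scale /=; ring.
- apply: (is_derive0_interval I (fun x => Cf x * h x + Sf x * f x)) => // x Ix.
  have dfx := df x Ix; have dhx := dh x Ix.
  apply: is_derive_eq (is_deriveD (is_deriveM (dC x) dhx)
    (is_deriveM (dS x) dfx)) _.
  by rewrite /Cf /Sf /M /GRing.scale /=; ring.
Qed.

Lemma rotating_vector {R : realType} (I : set R) (al : R)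
    (P : R -> 'cV[R]_4) s s0 : is_interval I ->
  (forall x, I x -> forall i,
    is_derive x 1 (fun t => P t i 0 : R^o) ((- al *: X1 (P x)) i 0)) ->
  I s -> I s0 ->
  cos (al * s) *: P s + sin (al * s) *: X1 (P s)
  = cos (al * s0) *: P s0 + sin (al * s0) *: X1 (P s0).
Proof.
move=> itI dP Is Is0.
have dP0 x : I x -> is_derive x 1 (fun t => P t 0 0 : R^o) (al * P x 1 0).
  by move=> /dP /(_ 0); rewrite X1E mxE vec4E mulrNN.
have dP1 x : I x -> is_derive x 1 (fun t => P t 1 0 : R^o) (- al * P x 0 0).
  by move=> /dP /(_ 1); rewrite X1E mxE vec4E.
have dP2 x : I x -> is_derive x 1 (fun t => P t 2 0 : R^o) (al * P x 3 0).
  by move=> /dP /(_ 2); rewrite X1E mxE vec4E mulrNN.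
have dP3 x : I x -> is_derive x 1 (fun t => P t 3 0 : R^o) (- al * P x 2 0).
  by move=> /dP /(_ 3); rewrite X1E mxE vec4E.
have [e0 e1] := rotating_pair I al _ _ s s0 itI dP0 dP1 Is Is0.
have [e2 e3] := rotating_pair I al _ _ s s0 itI dP2 dP3 Is Is0.
by rewrite !X1E; apply: vec4_ext; rewrite !(vec4E, mxE) ?mulrN.
Qed.

Section Splitting.
Context {R : realType}.
Variables (tau : R) (I : set R) (gam : R -> 'cV[R]_4).
Variables (theta b : R) (beta : R -> R).
Hypothesis gamP : curve I gam.
Hypothesis gam' : forall s, I s ->
  derive1 gam s = cos theta *: E1 tau (gam s)
              + (sin theta * sin (beta s)) *: E2 (gam s)
              + (sin theta * cos (beta s)) *: E3 (gam s).
Hypothesis beta' : forall s, I s -> is_derive s 1 (beta : R -> R^o) b.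

Local Notation c := (cos theta).
Local Notation S := (sin theta).
Local Notation fr := (frame_comb tau).
Local Notation tc := (tau^-1 * c).

Let T s : R * R * R := (c, S * sin (beta s), S * cos (beta s)).

Lemma gam_entry s i : I s ->
  is_derive s 1 (fun t => gam t i 0 : R^o) (fr (T s) (gam s) i 0).
Proof.
move=> Is; have -> : fr (T s) (gam s) = derive1 gam s by rewrite gam'.
have dg : derivable gam s 1 by case: gamP => _ _ /(_ 0%N s Is).
have dgi := (derivable_mxP gam s 1).1 dg i 0.
by rewrite derive1E derive_mx // mxE; exact: derivableP.
Qed.

(** This is X1 gam' - (cos theta / tau) gam, written without a derivative so
    that one differentiation of the frame suffices. *)
Definition splitN s : 'cV[R]_4 :=
  fr (0, S * cos (beta s), - (S * sin (beta s))) (gam s).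

(** The part of the solution rotating with speed - al when al, al' are the two
    frequencies: (X1 gam' - al' gam) / (al - al') removes the other one. *)
Definition component (al al' : R) s : 'cV[R]_4 :=
  (al - al')^-1 *: (splitN s + (tc - al') *: gam s).

(** This contains the equation gam'' = b X1 gam' + a gam: as al + al' = - b and
    al al' = a, it factors into two first-order rotations. *)
Lemma component_derive (al al' : R) s i : I s ->
  al + al' = - b -> al * al' = acoef tau theta b ->
  is_derive s 1 (fun t => component al al' t i 0 : R^o)
    ((- al *: X1 (component al al' s)) i 0).
Proof.
move=> Is sE pE.
have dg j := gam_entry s j Is.
have db := beta' s Is.
pose Cb : R -> R^o := cos \o beta; pose Sb : R -> R^o := sin \o beta.
have dC : is_derive s 1 Cb (- sin (beta s) * b) by exact: is_derive1_comp.
have dS : is_derive s 1 Sb (cos (beta s) * b) by exact: is_derive1_comp.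
pose x (j : 'I_4) : R -> R^o := fun t => gam t j 0.
have dx j : is_derive s 1 (x j) (fr (T s) (gam s) j 0) by exact: dg.
have bE : b = - (al + al') by rewrite sE opprK.
have S2 : S ^+ 2 = (tc - al) * (tc - al').
  move: pE; rewrite acoefE bE => h.
  by apply/eqP; rewrite -subr_eq0; apply/eqP; rewrite mulrBl !mulrBr h; ring.
set k := (al - al')^-1.
(* All four coordinates of the component have this shape, with different
   indices and the sign e = 1 or -1. *)
have dcomp (j0 j1 j2 : 'I_4) (e : R) d :
  (forall t, component al al' t i 0
    = k * (S * (Cb t * x j1 t) + e * S * (Sb t * x j2 t)
           + (tc - al') * x j0 t)) ->
  k * (S * (cos (beta s) * fr (T s) (gam s) j1 0 - sin (beta s) * b * x j1 s)
    + e * S * (sin (beta s) * fr (T s) (gam s) j2 0 + cos (beta s) * b * x j2 s)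
    + (tc - al') * fr (T s) (gam s) j0 0) = d ->
  is_derive s 1 (fun t => component al al' t i 0 : R^o) d.
  move=> /funext -> <-.
  apply: is_derive_eq (is_deriveZ k (is_deriveD (is_deriveD
    (is_deriveZ S (is_deriveM dC (dx j1)))
    (is_deriveZ (e * S) (is_deriveM dS (dx j2))))
    (is_deriveZ (tc - al') (dx j0)))) _.
  by rewrite /Cb /Sb /GRing.scale /=; ring.
have e2 : sin (beta s) ^+ 2 = 1 - cos (beta s) ^+ 2 by exact: sin2cos2.
have i4 : [\/ i = 0, i = 1, i = 2 | i = 3].
  case: i {dcomp} => [[|[|[|[|i]]]] hi] //;
    [apply: Or41|apply: Or42|apply: Or43|apply: Or44]; exact: val_inj.
case: i4 dcomp => -> dcomp.
- apply: (dcomp 0 3 2 (-1)) => [t|].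
    rewrite /component /splitN frame_combE !(vec4E, mxE) /= /Cb /Sb /x /=.
    by rewrite -/k; ring.
  rewrite mxE X1E /component /splitN !frame_combE !(vec4E, mxE) /x /= -/k bE.
  by ring: e2 S2.
- apply: (dcomp 1 2 3 1) => [t|].
    rewrite /component /splitN frame_combE !(vec4E, mxE) /= /Cb /Sb /x /=.
    by rewrite -/k; ring.
  rewrite mxE X1E /component /splitN !frame_combE !(vec4E, mxE) /x /= -/k bE.
  by ring: e2 S2.
- apply: (dcomp 2 1 0 (-1)) => [t|].
    rewrite /component /splitN frame_combE !(vec4E, mxE) /= /Cb /Sb /x /=.
    by rewrite -/k; ring.
  rewrite mxE X1E /component /splitN !frame_combE !(vec4E, mxE) /x /= -/k bE.
  by ring: e2 S2.
- apply: (dcomp 3 0 1 1) => [t|].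
    rewrite /component /splitN frame_combE !(vec4E, mxE) /= /Cb /Sb /x /=.
    by rewrite -/k; ring.
  rewrite mxE X1E /component /splitN !frame_combE !(vec4E, mxE) /x /= -/k bE.
  by ring: e2 S2.
Qed.

Lemma component_sum (al al' : R) s : al != al' ->
  component al al' s + component al' al s = gam s.
Proof.
rewrite -subr_eq0 => d0.
have e : (al' - al)^-1 = - (al - al')^-1 by rewrite -invrN opprB.
rewrite /component e scaleNr -scalerBr opprD addrACA subrr add0r -scalerBl.
have -> : tc - al' - (tc - al) = al - al' by ring.
by rewrite scalerA mulVf // scale1r.
Qed.

Lemma lor_splitN s : SL2 (gam s) ->
  [/\ lor (splitN s) (splitN s) = - S ^+ 2, lor (splitN s) (gam s) = 0,
      lor (splitN s) (X1 (splitN s)) = 0 & lor (splitN s) (X1 (gam s)) = 0].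
Proof.
move=> g1; split.
- have -> : lor (splitN s) (splitN s)
    = - S ^+ 2 * (cos (beta s) ^+ 2 + sin (beta s) ^+ 2) * lor (gam s) (gam s).
    by rewrite /splitN frame_combE /lor !vec4E /=; ring.
  by rewrite g1 cos2Dsin2 !mulr1.
- by rewrite lorC lor_frame_comb.
- exact: lor_self_X1.
- by rewrite /splitN frame_combE X1E /lor !vec4E /=; ring.
Qed.

(** The relation on sin^2 theta is equivalent to al al' = a once al + al' = - b,
    and is just what makes the two components orthogonal. *)
Lemma lor_component (al al' : R) s : SL2 (gam s) -> al != al' ->
  S ^+ 2 = (tc - al) * (tc - al') ->
  [/\ lor (component al al' s) (component al al' s) = (tc - al') / (al - al'),
      lor (component al' al s) (component al al' s) = 0
    & lor (component al' al s) (X1 (component al al' s)) = 0].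
Proof.
move=> g1; rewrite -subr_eq0 => d0 S2; have [NN Ng NXN NXg] := lor_splitN s g1.
have XD (k : R) (u v : 'cV[R]_4) : X1 (u + k *: v) = X1 u + k *: X1 v.
  by have := X1_lin 1 k u v; rewrite !scale1r.
have XZ (k : R) (u : 'cV[R]_4) : X1 (k *: u) = k *: X1 u.
  by have := X1_lin k 0 u u; rewrite !scale0r !addr0.
have gXN : lor (gam s) (X1 (splitN s)) = 0.
  by rewrite lorC lor_X1l NXg oppr0.
have gN : lor (gam s) (splitN s) = 0 by rewrite lorC.
have gXg := lor_self_X1 (gam s).
have expand (k l : R) u v : lor (splitN s + k *: gam s) (u + l *: v)
  = lor (splitN s) u + l * lor (splitN s) v + k * lor (gam s) u
    + k * l * lor (gam s) v.
  by rewrite /lor !mxE; ring.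
rewrite /component !XZ XD !lorZl !lorZr !expand.
rewrite NN Ng gN NXN NXg gXN gXg g1 S2; split.
- by move: d0; generalize (tau^-1 * c) => x d0; field.
- by ring.
- by rewrite !(mulr0, addr0).
Qed.

End Splitting.

Definition rot {R : realType} (x : R) (u : 'cV[R]_4) : 'cV[R]_4 :=
  cos x *: u + sin x *: X1 u.

Lemma lor_rot {R : realType} x (u : 'cV[R]_4) :
  lor (rot x u) (rot x u) = lor u u.
Proof.
have -> : lor (rot x u) (rot x u) = (cos x ^+ 2 + sin x ^+ 2) * lor u u.
  by rewrite /rot X1E /lor !(vec4E, mxE); ring.
by rewrite cos2Dsin2 mul1r.
Qed.

(** Hermitian orthogonality, unlike real orthogonality, survives independent
    rotations of the two vectors. *)
Lemma lor_rot2 {R : realType} x y (u v : 'cV[R]_4) :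
  lor u v = 0 -> lor u (X1 v) = 0 ->
  lor (rot x u) (rot y v) = 0 /\ lor (rot x u) (X1 (rot y v)) = 0.
Proof.
move=> uv uXv; split.
  transitivity ((cos x * cos y + sin x * sin y) * lor u v
     + (cos x * sin y - sin x * cos y) * lor u (X1 v)).
    by rewrite /rot !X1E /lor !(vec4E, mxE); ring.
  by rewrite uv uXv !mulr0 addr0.
transitivity ((cos x * cos y + sin x * sin y) * lor u (X1 v)
     - (cos x * sin y - sin x * cos y) * lor u v).
  by rewrite /rot !X1E /lor !(vec4E, mxE); ring.
by rewrite uv uXv !mulr0 subr0.
Qed.

Lemma rotK {R : realType} x (u : 'cV[R]_4) :
  cos x *: rot x u - sin x *: X1 (rot x u) = u.
Proof.
have -> : cos x *: rot x u - sin x *: X1 (rot x u)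
  = (cos x ^+ 2 + sin x ^+ 2) *: u.
  by rewrite /rot !X1E; apply: vec4_ext; rewrite !(vec4E, mxE); ring.
by rewrite cos2Dsin2 scale1r.
Qed.

(** Freezing the rotation at s0 gives the constant vector; undoing it at s
    recovers the moving one. *)
Lemma rotating_vectorE {R : realType} (I : set R) (al : R)
    (P : R -> 'cV[R]_4) s s0 : is_interval I ->
  (forall x, I x -> forall i,
    is_derive x 1 (fun t => P t i 0 : R^o) ((- al *: X1 (P x)) i 0)) ->
  I s -> I s0 ->
  P s = cos (al * s) *: rot (al * s0) (P s0)
        - sin (al * s) *: X1 (rot (al * s0) (P s0)).
Proof.
move=> itI dP Is Is0; rewrite -[LHS](rotK (al * s)).
suff -> : rot (al * s) (P s) = rot (al * s0) (P s0) by [].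
exact: (rotating_vector I).
Qed.

Theorem theorem5p1 (R : realType) (tau : R) (nabla : connection_type R)
    (I : set R) (gam : R -> 'cV[R]_4) (theta : R) (beta : R -> R)
    (tau_gt0 : 0 < tau)
    (nablaP : levi_civita tau nabla)
    (gamP : curve I gam)
    (gam_arc : arc_length tau I gam)
    (gam_bih : proper_biharmonic tau nabla I gam)
    (theta_gt0 : 0 < theta) (theta_le : theta <= pi / 2)
    (beta_smooth : smooth_on I (beta : R -> R^o))
    (gam' : forall s, I s ->
       derive1 gam s = cos theta *: E1 tau (gam s)
                   + (sin theta * sin (beta s)) *: E2 (gam s)
                   + (sin theta * cos (beta s)) *: E3 (gam s))
    (b2_gt4a : forall s, I s ->
       4 * acoef tau theta (rderiv beta s)
         < rderiv beta s ^+ 2) :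
  exists b : R,
    let a := acoef tau theta b in
    [/\ forall s, I s -> rderiv beta s = b,
        (b = - tau^-1 * (2 + tau ^+ 2) * cos theta
             + Num.sqrt ((4 + 5 * tau ^+ 2) * cos theta ^+ 2
                         - 4 * (1 + tau ^+ 2))
         /\ 4 * (1 + tau ^+ 2) / (4 + 5 * tau ^+ 2) <= cos theta ^+ 2
         /\ cos theta ^+ 2
              < (2 + tau ^+ 2) ^+ 2 / (4 + 5 * tau ^+ 2 + tau ^+ 4))
        \/
        (b = - tau^-1 * (2 + tau ^+ 2) * cos theta
             - Num.sqrt ((4 + 5 * tau ^+ 2) * cos theta ^+ 2
                         - 4 * (1 + tau ^+ 2))
         /\ 4 * (1 + tau ^+ 2) / (4 + 5 * tau ^+ 2) <= cos theta ^+ 2),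
        real_constants tau theta a b
      & exists A : 'M[R]_4,
          [/\ O2_4 A, J1 *m A = - (A *m J1)
            & forall s, I s ->
                gam s = A *m vec4
                  (Num.sqrt (C33 tau theta a b) * cos (alpha2 a b * s))
                  (Num.sqrt (C33 tau theta a b) * sin (alpha2 a b * s))
                  (Num.sqrt (- C11 tau theta a b) * cos (alpha1 a b * s))
                  (Num.sqrt (- C11 tau theta a b) * sin (alpha1 a b * s))]].
Proof.
have [sin0 cos0] := sin_cos_sign theta theta_gt0 theta_le.
have [b [[s0 Is0] beta'E bE]] := proper_biharmonic_angle tau nabla I gam theta
  beta tau_gt0 nablaP gamP beta_smooth gam' sin0 gam_bih.
exists b; set a := acoef tau theta b; rewrite /=.
have b2a : 4 * a < b ^+ 2 by rewrite /a -(beta'E s0 Is0); exact: b2_gt4a.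
have cS := cos2Dsin2 theta.
have aE := acoefE tau theta b.
have [a12s a12p tca2 a2a1] := alpha_roots tau (cos theta) b a (sin theta) tau^-1
  tau_gt0 cos0 sin0 cS erefl aE b2a bE.
set a1 := alpha1 a b in a12s a12p a2a1.
set a2 := alpha2 a b in a12s a12p tca2 a2a1.
have d0 : 0 < a1 - a2 by rewrite subr_gt0.
have b0 := neg_b_gt0 tau (cos theta) b a (sin theta) tau^-1
  tau_gt0 cos0 sin0 cS erefl aE b2a bE.
have s_neq0 : a1 + a2 != 0 by rewrite a12s gt_eqF.
have d_neq0 : a1 - a2 != 0 by rewrite gt_eqF.
have C33e := C33E tau theta b a12s a12p s_neq0 d_neq0.
have C11e := C11E tau theta b a12s a12p s_neq0 d_neq0.
have C33_gt0 : 0 < C33 tau theta a b.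
  by rewrite C33e divr_gt0 // subr_gt0 (lt_trans tca2).
have C11_gt0 : 0 < - C11 tau theta a b.
  by rewrite C11e divr_gt0 // subr_gt0.
split=> //.
- have c2 := cos2_ge tau (cos theta) b tau^-1 tau_gt0 bE.
  (* The radicand is q^2, so the square root is q or - q. *)
  rewrite -bE sqrtr_sqr.
  case: (leP 0 (b + tau^-1 * (2 + tau ^+ 2) * cos theta)) => q0.
  + left; split; first by rewrite ger0_norm //; ring.
    split=> //; exact: (cos2_lt tau (cos theta) b a (sin theta) tau^-1).
  + right; split=> //; rewrite ltr0_norm //; ring.
- split.
  + by rewrite mulr_ge0 ?sqr_ge0 // subr_ge0 ltW.
  + rewrite (sqrt_b2D tau (cos theta) b a (sin theta) tau^-1) //.
    rewrite -[leRHS](@divfK _ 2) ?pnatr_eq0 //.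
    rewrite (alpha2_sqr b a b2a) mulr_ge0 ?sqr_ge0 //.
  + by rewrite -subr_eq0 subr_sqr mulf_neq0.
  + exact: ltW.
  + exact: ltW.
pose tc := tau^-1 * cos theta.
have S2 : sin theta ^+ 2 = (tc - a1) * (tc - a2).
  have -> : sin theta ^+ 2 = a + tc ^+ 2 + tc * b by rewrite /a aE /tc; ring.
  by rewrite -a12p -[b]opprK -a12s; ring.
have S2' : sin theta ^+ 2 = (tc - a2) * (tc - a1) by rewrite mulrC.
have g1 : SL2 (gam s0) by case: gamP => _ _ _; exact.
have dbeta s : I s -> is_derive s 1 (beta : R -> R^o) b.
  move=> Is; rewrite -(beta'E s Is) /rderiv derive1E; apply: derivableP.
  exact: (beta_smooth 0%N).
have itI : is_interval I by case: gamP.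
pose P1 := component tau gam theta beta a1 a2.
pose P2 := component tau gam theta beta a2 a1.
have a1n2 : a1 != a2 by rewrite gt_eqF.
have a2n1 : a2 != a1 by rewrite lt_eqF.
have [n1 o1 o2] := lor_component tau gam theta beta a1 a2 s0 g1 a1n2 S2.
have [n2 _ _] := lor_component tau gam theta beta a2 a1 s0 g1 a2n1 S2'.
have {}n1 : lor (P1 s0) (P1 s0) = C11 tau theta a b.
  by rewrite n1 -[RHS]opprK C11e -mulNr opprB.
have {}n2 : lor (P2 s0) (P2 s0) = C33 tau theta a b.
  by rewrite n2 C33e -[RHS]mulrNN -invrN !opprB.
pose W1 := rot (a1 * s0) (P1 s0); pose W2 := rot (a2 * s0) (P2 s0).
have P1E s : I s -> P1 s = cos (a1 * s) *: W1 - sin (a1 * s) *: X1 W1.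
  move=> Is; apply: (rotating_vectorE I) => // x Ix i.
  exact: (component_derive tau I gam theta b beta).
have P2E s : I s -> P2 s = cos (a2 * s) *: W2 - sin (a2 * s) *: X1 W2.
  move=> Is; apply: (rotating_vectorE I) => // x Ix i.
  apply: (component_derive tau I gam theta b beta) => //.
    by rewrite addrC.
  by rewrite mulrC.
have [ort ortX] := lor_rot2 (a2 * s0) (a1 * s0) _ _ o1 o2.
set k1 := Num.sqrt (- C11 tau theta a b).
set k2 := Num.sqrt (C33 tau theta a b).
have k1_gt0 : 0 < k1 by rewrite sqrtr_gt0.
have k2_gt0 : 0 < k2 by rewrite sqrtr_gt0.
have XZ (k : R) (x : 'cV[R]_4) : X1 (k *: x) = k *: X1 x.
  by have := X1_lin k 0 x x; rewrite !scale0r !addr0.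
pose u := k2^-1 *: W2; pose v := k1^-1 *: W1.
have uu : lor u u = 1.
  rewrite lorZl lorZr lor_rot n2 mulrA -invfM -expr2 sqr_sqrtr ?ltW //.
  by rewrite mulVf ?gt_eqF.
have vv : lor v v = -1.
  rewrite lorZl lorZr lor_rot n1 mulrA -invfM -expr2 sqr_sqrtr ?ltW //.
  by rewrite -[X in _ * X]opprK mulrN mulVf ?gt_eqF.
have uv : lor u v = 0 by rewrite lorZl lorZr ort !mulr0.
have uXv : lor u (X1 v) = 0 by rewrite XZ lorZl lorZr ortX !mulr0.
have [AO AJ] := O2_4_anticommuting u v uu vv uv uXv.
(* The amplitudes k1, k2 cancel the normalization of u and v. *)
exists (of_cols u (- X1 u) v (- X1 v)); split=> // s Is.
rewrite -(component_sum tau gam theta beta a1 a2 s a1n2).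
rewrite -/(P1 s) -/(P2 s) P1E // P2E // of_cols_mul.
rewrite -/a1 -/a2 -/k1 -/k2 /u /v !XZ.
have cancel k x : k != 0 -> (k * x) * k^-1 = x :> R.
  by move=> k0; rewrite mulrAC divff // mul1r.
rewrite !scalerN !scalerA !cancel ?gt_eqF //.
by rewrite [LHS]addrC [LHS]addrA.
Qed.
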